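(* Let $T \in \mathcal{B}(\mathcal{H})$. Then for every $n\in\mathbb{N}$ with $n\geq 2$, \[w(T) \leq \sqrt[n]{ \log \left[ \frac{1}{2^{n-1}} e^{w(T^n)} + \left( 1-\frac{1}{2^{n-1}}\right) e^{\|T\|^n}\right]} \leq \|T\|.\] In particular, for $n=2$, \[w(T) \leq \sqrt{\log \left( \frac{1}{2} e^{w(T^2)} +\frac12 e^{\|T\|^2} \right)} \leq \|T\|.\]
   Context: $\mathcal{B}(\mathcal{H})$ is the algebra of bounded linear operators on a complex Hilbert space $\mathcal{H}$. For $T\in\mathcal{B}(\mathcal{H})$, $\|T\|$ is the operator norm and $w(T)=\sup_{\|x\|=1}|\langle Tx,x\rangle|$ is the numerical radius. *)

(* Defs.v *)
From HB Require Import structures.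
From mathcomp Require Import all_boot all_order all_algebra.
From mathcomp Require Import sesquilinear complex.
From mathcomp Require Import all_classical all_reals all_analysis.

Set Implicit Arguments.
Unset Strict Implicit.
Unset Printing Implicit Defensive.

Import Order.TTheory GRing.Theory Num.Theory.
Import numFieldNormedType.Exports.

Local Open Scope classical_set_scope.
Local Open Scope ring_scope.
Local Open Scope complex_scope.

(* [hdot] is linear in its first argument and conjugate-linear in its second;
   positive definiteness is part of [{dot _ for _}]. *)
HB.mixin Record NormedModule_isHilbert (R : realType) H
    of CompleteNormedModule R[i] H := {
  hdot : {dot H for (@Num.conj R[i])};
  hdotE : forall x : H, `|x| ^+ 2 = hdot x x
}.

#[short(type="hilbertType")]
HB.structure Definition Hilbert (R : realType) :=
  {H of CompleteNormedModule R[i] H & NormedModule_isHilbert R H}.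

Section Operators.
Variables (R : realType) (H : hilbertType R).
Implicit Type T : H -> H.

Definition bounded_operator T :=
  exists M : R, forall x, `|T x| <= M%:C * `|x|.

(* Norms and moduli over [R[i]] take their values in [R[i]]; being real, they
   are read in [R] through [complex.Re].  On the zero space the set below is
   empty and its [sup] is 0. *)
Definition numerical_radius T : R :=
  sup [set complex.Re `|hdot (T x) x| | x in [set x : H | `|x| = 1]].

Definition operator_norm T : R :=
  sup [set complex.Re `|T x| | x in [set x : H | `|x| <= 1]].

End Operators.

(* Main.v *)
(* Fix a unit vector x.  The reflection v = 2 <u, x> x - u satisfies |v| = |u|
   and 2 <u, x> <T x, x> = <T u, x> + <T v, x>, so
   2 |<u, x> <T x, x>| <= |<T u, x>| + |T| |u|.  Taking u = T^k x, induction on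
   k gives |<T x, x>|^n <= 2^(1-n) |<T^n x, x>| + (1 - 2^(1-n)) |T|^n.
   Taking the supremum over x and exponentiating, convexity of exp concludes. *)
Require Import Defs.
From HB Require Import structures.
From mathcomp Require Import all_boot all_order all_algebra.
From mathcomp Require Import sesquilinear complex.
From mathcomp Require Import all_classical all_reals all_analysis.
From mathcomp Require Import ring lra.

Set Implicit Arguments.
Unset Strict Implicit.
Unset Printing Implicit Defensive.

Import Order.TTheory GRing.Theory Num.Theory.
Import numFieldNormedType.Exports.

Local Open Scope ring_scope.

Lemma invr_expr2_itv (R : realFieldType) n : 0 <= (2 ^+ n : R)^-1 <= 1.
Proof.
by rewrite invr_ge0 exprn_ge0//= invf_le1 ?exprn_gt0// exprn_ege1// ler1n.
Qed.

Lemma normrE_Re (R : realType) (V : normedModType R[i]) (x : V) :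
  (complex.Re `|x|)%:C%C = `|x|.
Proof. by rewrite RRe_real// ger0_real. Qed.

Lemma Re_norm_ge0 (R : realType) (V : normedModType R[i]) (x : V) :
  0 <= complex.Re `|x|.
Proof. by rewrite -lecR normrE_Re normr_ge0. Qed.

Section Hilbert.
Variables (R : realType) (H : hilbertType R).
Implicit Types (x u : H) (N : R).

(** Expansion behind the next two lemmas: a = <u, x> gives the distance from u to its projection,
    and a = 2 <u, x> makes |a|^2 = 4 |<u, x>|^2 cancel the cross terms. *)
Lemma normB_scale_unit x u (a : R[i]) : `|x| = 1 ->
  `|a *: x - u| ^+ 2 =
  `|a| ^+ 2 + `|u| ^+ 2 - (a * (hdot u x)^* + (a * (hdot u x)^*)^*).
Proof.
move=> x1; rewrite hdotE dnormB dnormZ -!hdotE x1 expr1n mulr1.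
by rewrite linearZl_LR/= (hermC _ x u) expr0 mul1r.
Qed.

(** Cauchy-Schwarz by Pythagoras: |u|^2 - |<u, x>|^2 is the squared norm of <u, x> x - u. *)
Lemma norm_hdot_unit x u : `|x| = 1 -> `|hdot u x| <= `|u|.
Proof.
move=> x1; have := normB_scale_unit u (hdot u x) x1.
rewrite -normCK rmorphXn/= conj_normC => e.
rewrite -(@ler_pXn2r _ 2) ?nnegrE// -subr_ge0.
suff -> : `|u| ^+ 2 - `|hdot u x| ^+ 2 = `|hdot u x *: x - u| ^+ 2.
  by rewrite exprn_ge0.
by rewrite e; ring.
Qed.

(* [u |-> 2 <u, x> x - u] is the reflection across the line spanned by [x]. *)
Lemma norm_reflection x u : `|x| = 1 -> `|(2 * hdot u x) *: x - u| = `|u|.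
Proof.
move=> x1; have := normB_scale_unit u (2 * hdot u x) x1.
rewrite -mulrA -normCK normrM normr_nat rmorphM rmorphXn/= conj_normC conjC_nat.
move=> e; apply/eqP; rewrite -(@eqrXn2 _ 2)//; apply/eqP; rewrite e; ring.
Qed.

(** Buzano's inequality for the vectors u and T^* x, with [N] bounding |T^* x|; the reflection of u
    avoids any use of the adjoint. *)
Lemma buzano_operator (T : {linear H -> H}) N x u :
  (forall y, `|T y| <= N%:C%C * `|y|) -> `|x| = 1 ->
  2 * (complex.Re `|hdot u x| * complex.Re `|hdot (T x) x|)
    <= complex.Re `|hdot (T u) x| + N * complex.Re `|u|.
Proof.
move=> TN x1; rewrite -lecR !(rmorphM, rmorphD, rmorph_nat)/= !normrE_Re.
pose v := (2 * hdot u x) *: x - u.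
have -> : 2 * (`|hdot u x| * `|hdot (T x) x|) = `|hdot (T u) x + hdot (T v) x|.
  rewrite linearB linearZ/= linearBl linearZl_LR/= addrC subrK.
  by rewrite !normrM normr_nat mulrA.
rewrite (le_trans (ler_normD _ _))// lerD2l.
by rewrite (le_trans (norm_hdot_unit _ x1))// (le_trans (TN _))// norm_reflection.
Qed.

Lemma norm_iter_le (T : H -> H) N k x : 0 <= N ->
  (forall y, `|T y| <= N%:C%C * `|y|) ->
  `|iter k T x| <= (N ^+ k)%:C%C * `|x|.
Proof.
move=> N0 TN; elim: k => [|k IH] /=; first by rewrite expr0 mul1r.
rewrite (le_trans (TN _))// exprS rmorphM/= -mulrA ler_wpM2l//.
by rewrite lecR.
Qed.

Lemma Re_hdot_iter_le (T : H -> H) N k x : 0 <= N ->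
  (forall y, `|T y| <= N%:C%C * `|y|) -> `|x| = 1 ->
  complex.Re `|hdot (iter k T x) x| <= N ^+ k.
Proof.
move=> N0 TN x1; rewrite -lecR normrE_Re (le_trans (norm_hdot_unit _ x1))//.
by rewrite (le_trans (norm_iter_le _ _ N0 TN))// x1 mulr1.
Qed.

Lemma numerical_power_le (T : {linear H -> H}) N x k :
  0 <= N -> (forall y, `|T y| <= N%:C%C * `|y|) -> `|x| = 1 ->
  complex.Re `|hdot (T x) x| ^+ k.+1 <=
    (2 ^+ k)^-1 * complex.Re `|hdot (iter k.+1 T x) x|
    + (1 - (2 ^+ k)^-1) * N ^+ k.+1.
Proof.
move=> N0 TN x1; elim: k => [|k IH].
  by rewrite expr0 invr1 subrr mul0r addr0 mul1r.
set a := complex.Re _ in IH *; set b := complex.Re _ in IH.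
set b' := complex.Re `|hdot (iter k.+2 T x) x|.
set c := (2 ^+ k)^-1 in IH *.
have a0 : 0 <= a by exact: Re_norm_ge0.
have aN : a <= N by have := Re_hdot_iter_le 1 N0 TN x1; rewrite expr1.
(* Buzano at u = T^(k+1) x, whose norm is at most N^(k+1). *)
have bb' : 2 * (b * a) <= b' + N ^+ k.+2.
  apply: le_trans (buzano_operator (iter k.+1 T x) TN x1) _.
  rewrite lerD2l exprS ler_wpM2l// -lecR normrE_Re.
  by rewrite (le_trans (norm_iter_le _ _ N0 TN))// x1 mulr1.
rewrite [2 ^+ k.+1]exprS invfM -/c.
(* Multiplying the induction hypothesis by a leaves c b a + (1 - c) N^(k+1) a. The first term is at
   most (c/2) (b' + N^(k+2)), the second at most (1 - c) N^(k+2), and c/2 + (1 - c) = 1 - c/2 is the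
   new weight. *)
have := ler_wpM2r a0 IH; rewrite -exprSr => /le_trans; apply.
have Na : N ^+ k.+1 * a <= N ^+ k.+2 by rewrite [leRHS]exprSr ler_wpM2l// exprn_ge0.
have /andP[c0 c1] : 0 <= c <= 1 := invr_expr2_itv R k.
have h1 : (1 - c) * (N ^+ k.+1 * a) <= (1 - c) * N ^+ k.+2.
  by rewrite ler_wpM2l// subr_ge0.
have h2 := ler_wpM2l c0 bb'.
lra.
Qed.

Lemma has_ubound_operator_norm (T : H -> H) : bounded_operator T ->
  has_ubound [set complex.Re `|T x| | x in [set x : H | `|x| <= 1]]%classic.
Proof.
(* On the zero space [M] may be negative, hence the absolute value. *)
case=> M TM; exists `|M| => _ [x x1 <-].
rewrite -lecR normrE_Re (le_trans (TM x))//.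
apply: (@le_trans _ _ (`|M|%:C%C * `|x|)).
  by rewrite ler_wpM2r// lecR ler_norm.
by rewrite ler_piMr// lecR.
Qed.

Lemma operator_norm_ge0 (T : H -> H) : bounded_operator T -> 0 <= operator_norm T.
Proof.
move=> /has_ubound_operator_norm bT.
apply: (le_trans (Re_norm_ge0 (T 0))).
by apply: ub_le_sup => //; exists 0 => //=; rewrite normr0.
Qed.

Lemma le_operator_norm (T : {linear H -> H}) x : bounded_operator T ->
  `|T x| <= (operator_norm T)%:C%C * `|x|.
Proof.
move=> /has_ubound_operator_norm bT.
have [->|x0] := eqVneq x 0; first by rewrite linear0 !normr0 mulr0.
have nx : `|x| \is a GRing.unit by rewrite unitfE normr_eq0.
have y1 : `| `|x|^-1 *: x| = 1.
  by rewrite normrZ normfV normr_id mulVr.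
have : complex.Re `|T (`|x|^-1 *: x)| <= operator_norm T.
  by apply: ub_le_sup => //; exists (`|x|^-1 *: x) => //=; rewrite y1.
rewrite -lecR normrE_Re linearZ normrZ normfV normr_id mulrC.
by rewrite ler_pdivrMr// normr_gt0.
Qed.

Lemma numerical_radius_ge0 (T : H -> H) N :
  (forall x, `|x| = 1 -> complex.Re `|hdot (T x) x| <= N) ->
  0 <= numerical_radius T.
Proof.
move=> TN; rewrite /numerical_radius.
set A := (X in sup X).
have [->|/set0P[r Ar]] := eqVneq A classical_sets.set0; first by rewrite sup0.
have r0 : 0 <= r by case: Ar => x _ <-; exact: Re_norm_ge0.
apply: le_trans r0 _; apply: ub_le_sup => //.
by exists N => _ [x x1 <-]; exact: TN.
Qed.

Lemma hdot_le_numerical_radius (T : H -> H) N x :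
  (forall x, `|x| = 1 -> complex.Re `|hdot (T x) x| <= N) -> `|x| = 1 ->
  complex.Re `|hdot (T x) x| <= numerical_radius T.
Proof.
move=> TN x1; apply: ub_le_sup; last by exists x.
by exists N => _ [y y1 <-]; exact: TN.
Qed.

(** The hypothesis [0 <= N] covers the zero space, where there is no unit vector and [sup] returns
    0. *)
Lemma numerical_radius_le (T : H -> H) N : 0 <= N ->
  (forall x, `|x| = 1 -> complex.Re `|hdot (T x) x| <= N) ->
  numerical_radius T <= N.
Proof.
move=> N0 TN; rewrite /numerical_radius.
set A := (X in sup X).
have [->|/set0P A0] := eqVneq A classical_sets.set0; first by rewrite sup0.
by apply: ge_sup => // _ [x x1 <-]; exact: TN.
Qed.

End Hilbert.

(** The lower bound is convexity of exp; the upper one holds because a weighted mean of [expR a] and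
    [expR b] is at most [expR b]. *)
Lemma ln_convex_expR_bounds (R : realType) (c a b : R) : 0 <= c <= 1 -> a <= b ->
  c * a + (1 - c) * b <= ln (c * expR a + (1 - c) * expR b) <= b.
Proof.
move=> /andP[c0 c1] ab.
have cvx : expR (c * a + (1 - c) * b) <= c * expR a + (1 - c) * expR b.
  have := convex_expR (Itv01 c0 c1) a b.
  by rewrite !convRE.
have pos := lt_le_trans (expR_gt0 _) cvx.
apply/andP; split.
  by rewrite -[leLHS]expRK ler_ln// posrE expR_gt0.
rewrite -[leRHS]expRK ler_ln ?posrE ?expR_gt0//.
have : c * expR a <= c * expR b by rewrite ler_wpM2l// ler_expR.
lra.
Qed.

Theorem corollary2p29 (R : realType) (H : hilbertType R) (T : {linear H -> H})
    (bT : bounded_operator T) :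
  (forall n : nat, (2 <= n)%N ->
     numerical_radius T <=
       ln ((2 ^+ n.-1)^-1 * expR (numerical_radius (iter n T))
           + (1 - (2 ^+ n.-1)^-1) * expR (operator_norm T ^+ n)) `^ n%:R^-1
       <= operator_norm T) /\
  numerical_radius T <=
    Num.sqrt (ln (2^-1 * expR (numerical_radius (iter 2 T))
                  + 2^-1 * expR (operator_norm T ^+ 2)))
    <= operator_norm T.
Proof.
have N0 := operator_norm_ge0 bT.
have TN y := le_operator_norm y bT.
set N := operator_norm T in N0 TN *.
pose L n := ln ((2 ^+ n.-1)^-1 * expR (numerical_radius (iter n T))
           + (1 - (2 ^+ n.-1)^-1) * expR (N ^+ n)).
have TnN n x := @Re_hdot_iter_le _ _ T N n x N0 TN.
have w0 n : 0 <= numerical_radius (iter n T) := numerical_radius_ge0 (TnN n).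
have LN n : (2 ^+ n.-1)^-1 * numerical_radius (iter n T)
    + (1 - (2 ^+ n.-1)^-1) * N ^+ n <= L n <= N ^+ n.
  apply: ln_convex_expR_bounds (invr_expr2_itv R _) _.
  exact: numerical_radius_le (exprn_ge0 _ N0) (TnN n).
(* Monotonicity of the n-th root and the passage from the power 1/2 to [Num.sqrt] both require a
   nonnegative base. *)
have L0 n : 0 <= L n.
  have /andP[+ _] := LN n; apply: le_trans.
  have /andP[c0 c1] := invr_expr2_itv R n.-1.
  by rewrite addr_ge0// mulr_ge0 ?exprn_ge0// subr_ge0.
have main n : (0 < n)%N -> numerical_radius T <= L n `^ n%:R^-1 <= N.
  case: n => // k _; have /andP[lL LN'] := LN k.+1.
  have root (z : R) : 0 <= z -> (z ^+ k.+1) `^ k.+1%:R^-1 = z.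
    by move=> z0; rewrite -powR_mulrn// -powRrM divff ?pnatr_eq0// powRr1.
  apply/andP; split; last first.
    rewrite -[leRHS]root//; apply: ge0_ler_powR => //; rewrite nnegrE//.
    exact: exprn_ge0.
  apply: numerical_radius_le; first exact: powR_ge0.
  move=> x x1; have a0 := Re_norm_ge0 (hdot (T x) x).
  rewrite -[leLHS]root//; apply: ge0_ler_powR => //; rewrite ?nnegrE ?exprn_ge0//.
  (* With n = k+1, |<T x, x>|^n is bounded through |<T^n x, x>|, which is then replaced by w(T^n) to
     reach the lower bound of [L n]. *)
  apply: le_trans lL; apply: le_trans (numerical_power_le k N0 TN x1) _.
  rewrite lerD2r ler_wpM2l//.
  exact: hdot_le_numerical_radius (TnN k.+1) x1.
split=> [n n2|]; first by apply: main; apply: leq_trans n2.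
have := main 2 isT; rewrite powR12_sqrt// /L expr1.
by have -> : 1 - 2^-1 = 2^-1 :> R by lra.
Qed.
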